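(* Let $\mathbf{C}$ be a locally small category, $(T, \mu, \eta)$ a monad on $\mathbf{C}$, and let $\mathbf{K} = \mathbf{K}(T, \mu, \eta)$ and $\mathbf{EM} = \mathbf{EM}(T, \mu, \eta)$ be the Kleisli category and the Eilenberg-Moore category, respectively, for the monad. If $\mathbf{C}$ has the dual Ramsey property then so do both $\mathbf{K}$ and $\mathbf{EM}$.
   Context: A locally small category $\mathbf{C}$ has the dual Ramsey property if for every integer $k\ge 2$ and all objects $A,B$ of $\mathbf{C}$ there is an object $C$ of $\mathbf{C}$ such that for every coloring $\chi:\hom_{\mathbf{C}}(C,A)\to\{0,\dots,k-1\}$ there is a morphism $w\in\hom_{\mathbf{C}}(C,B)$ with $|\chi(\{f\cdot w:f\in\hom_{\mathbf{C}}(B,A)\})|\le 1$. The Kleisli category has the same objects as $\mathbf{C}$, $\hom_{\mathbf{K}}(A,B)=\hom_{\mathbf{C}}(A,T(B))$, and the composition of $f\in\hom_{\mathbf{K}}(A,B)$ and $g\in\hom_{\mathbf{K}}(B,C)$ is $g\cdot_{\mathbf{K}}f=\mu_C\cdot T(g)\cdot f$. The Eilenberg-Moore category has as objects the pairs $(A,\alpha)$ with $\alpha\in\hom_{\mathbf{C}}(T(A),A)$ such that $\alpha\cdot T(\alpha)=\alpha\cdot\mu_A$ and $\alpha\cdot\eta_A=\mathrm{id}_A$; morphisms $(A,\alpha)\to(B,\beta)$ are the $f\in\hom_{\mathbf{C}}(A,B)$ with $f\cdot\alpha=\beta\cdot T(f)$, composed as in $\mathbf{C}$. *)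

(* Defs.v *)
From mathcomp Require Import all_boot boolp classical_sets functions cardinality.

Set Implicit Arguments.
Unset Strict Implicit.
Unset Printing Implicit Defensive.

Declare Scope cat_scope.
Delimit Scope cat_scope with cat.
Local Open Scope cat_scope.

Reserved Notation "g ∘ f" (at level 40, left associativity).

(* Local smallness is the fact that hom-sets are types, in a universe that does
   not depend on the objects.  Equality of morphisms is Leibniz equality, and
   composition is written in applicative order, as g ∘ f. *)
Record category := Category {
  obj :> Type;
  hom : obj -> obj -> Type;
  ident : forall A, hom A A;
  compose : forall A B C, hom B C -> hom A B -> hom A C;
  compose_idl : forall A B (f : hom A B), compose (ident B) f = f;
  compose_idr : forall A B (f : hom A B), compose f (ident A) = f;
  compose_assoc : forall A B C D
    (h : hom C D) (g : hom B C) (f : hom A B),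
    compose h (compose g f) = compose (compose h g) f
}.

Arguments hom {_} _ _.
Arguments ident {_} A.
Arguments compose {_ A B C} g f.

Notation "g ∘ f" := (compose g f) : cat_scope.

Record functor (C D : category) := Functor {
  fobj :> C -> D;
  fmap : forall A B, hom A B -> hom (fobj A) (fobj B);
  fmap_id : forall A, fmap (ident A) = ident (fobj A);
  fmap_comp : forall A B E (g : hom B E) (f : hom A B),
    fmap (g ∘ f) = fmap g ∘ fmap f
}.

Arguments fmap {C D} F {A B} f : rename.

Definition idfunctor (C : category) : functor C C :=
  @Functor C C (fun A => A) (fun A B f => f)
    (fun=> erefl) (fun _ _ _ _ _ => erefl).

Section FunctorComposition.
Variables (C D E : category) (G : functor D E) (F : functor C D).

Lemma compfunctor_id (A : C) : fmap G (fmap F (ident A)) = ident (G (F A)).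
Proof. by rewrite !fmap_id. Qed.

Lemma compfunctor_comp (A B B' : C) (g : hom B B') (f : hom A B) :
  fmap G (fmap F (g ∘ f)) = fmap G (fmap F g) ∘ fmap G (fmap F f).
Proof. by rewrite !fmap_comp. Qed.

Definition compfunctor : functor C E :=
  @Functor C E (fun A => G (F A)) (fun A B f => fmap G (fmap F f))
    compfunctor_id compfunctor_comp.

End FunctorComposition.

Record nattrans (C D : category) (F G : functor C D) := NatTrans {
  component :> forall A : C, hom (F A) (G A);
  naturality : forall (A B : C) (f : hom A B),
    fmap G f ∘ component A = component B ∘ fmap F f
}.

Record monad (C : category) := Monad {
  mfunctor :> functor C C;
  mu : nattrans (compfunctor mfunctor mfunctor) mfunctor;
  eta : nattrans (idfunctor C) mfunctor;
  mu_assoc : forall A : C,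
    mu A ∘ fmap mfunctor (mu A) = mu A ∘ mu (mfunctor A);
  mu_etal : forall A : C, mu A ∘ eta (mfunctor A) = ident (mfunctor A);
  mu_etar : forall A : C,
    mu A ∘ fmap mfunctor (eta A) = ident (mfunctor A)
}.

Section Kleisli.
Variables (C : category) (T : monad C).

Definition kl_hom (A B : C) : Type := hom A (T B).

Definition kl_ident (A : C) : kl_hom A A := eta T A.

Definition kl_compose (A B D : C) (g : kl_hom B D) (f : kl_hom A B) :
  kl_hom A D := mu T D ∘ fmap T g ∘ f.

Lemma kl_compose_idl (A B : C) (f : kl_hom A B) :
  kl_compose (kl_ident B) f = f.
Proof. by rewrite /kl_compose mu_etar compose_idl. Qed.

Lemma kl_compose_idr (A B : C) (f : kl_hom A B) :
  kl_compose f (kl_ident A) = f.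
Proof.
rewrite /kl_compose /kl_ident -compose_assoc (naturality (eta T) f) /=.
by rewrite compose_assoc mu_etal compose_idl.
Qed.

Lemma kl_compose_assoc (A B D E : C)
    (h : kl_hom D E) (g : kl_hom B D) (f : kl_hom A B) :
  kl_compose h (kl_compose g f) = kl_compose (kl_compose h g) f.
Proof.
rewrite /kl_compose !fmap_comp !compose_assoc mu_assoc.
by rewrite -(compose_assoc _ (mu T D)) -(compose_assoc _ (mu T _))
           -(naturality (mu T) h) !compose_assoc.
Qed.

Definition kleisli : category :=
  @Category C kl_hom kl_ident kl_compose
    kl_compose_idl kl_compose_idr kl_compose_assoc.

End Kleisli.

Section EilenbergMoore.
Variables (C : category) (T : monad C).

Record em_obj := EMObj {
  carrier : C;
  action : hom (T carrier) carrier;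
  action_mu : action ∘ fmap T action = action ∘ mu T carrier;
  action_eta : action ∘ eta T carrier = ident carrier
}.

Record em_hom (A B : em_obj) := EMHom {
  em_val : hom (carrier A) (carrier B);
  em_valP : em_val ∘ action A = action B ∘ fmap T em_val
}.

Lemma em_hom_eq (A B : em_obj) (f g : em_hom A B) :
  em_val f = em_val g -> f = g.
Proof.
case: f g => [f fP] [g gP] /= fg; rewrite -{}fg in gP *.
by rewrite (Prop_irrelevance fP gP).
Qed.

Lemma em_identP (A : em_obj) :
  ident (carrier A) ∘ action A = action A ∘ fmap T (ident (carrier A)).
Proof. by rewrite fmap_id compose_idl compose_idr. Qed.

Definition em_ident (A : em_obj) : em_hom A A := EMHom (em_identP A).

Lemma em_composeP (A B D : em_obj) (g : em_hom B D) (f : em_hom A B) :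
  (em_val g ∘ em_val f) ∘ action A
  = action D ∘ fmap T (em_val g ∘ em_val f).
Proof.
by rewrite -compose_assoc em_valP compose_assoc em_valP -compose_assoc fmap_comp.
Qed.

Definition em_compose (A B D : em_obj) (g : em_hom B D) (f : em_hom A B) :
  em_hom A D := EMHom (em_composeP g f).

Lemma em_compose_idl (A B : em_obj) (f : em_hom A B) :
  em_compose (em_ident B) f = f.
Proof. exact/em_hom_eq/compose_idl. Qed.

Lemma em_compose_idr (A B : em_obj) (f : em_hom A B) :
  em_compose f (em_ident A) = f.
Proof. exact/em_hom_eq/compose_idr. Qed.

Lemma em_compose_assoc (A B D E : em_obj)
    (h : em_hom D E) (g : em_hom B D) (f : em_hom A B) :
  em_compose h (em_compose g f) = em_compose (em_compose h g) f.
Proof. exact/em_hom_eq/compose_assoc. Qed.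

Definition eilenberg_moore : category :=
  @Category em_obj em_hom em_ident em_compose
    em_compose_idl em_compose_idr em_compose_assoc.

End EilenbergMoore.

Local Open Scope classical_set_scope.
Local Open Scope card_scope.

(* `I_1 is the one-element set {0}, so that X #<= `I_1 reads |X| <= 1; the set
   of f ∘ w is empty when hom B A is, and only the existence of w remains. *)
Definition dual_ramsey (C : category) : Prop :=
  forall (k : nat), 2 <= k -> forall A B : C,
  exists D : C, forall chi : hom D A -> 'I_k,
  exists w : hom D B,
    chi @` [set f ∘ w | f in [set: hom B A]] #<= `I_1.

(* Main.v *)
Require Import Defs.
From mathcomp Require Import all_boot classical_sets cardinality.

(** Both categories are related to the base category by the adjunctions that
    define them, and such an adjunction transports colorings.

    In the Kleisli category a morphism from [D] to [A] is a morphism from [D] to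
    [T A] in the base category, and the Kleisli composite of [f] after [w] is
    [(mu A ∘ T f) ∘ w].  So an object [D] that works for [T A] and [T B] in the
    base category also works for [A] and [B] in the Kleisli category: the
    morphisms to be colored are among the [g ∘ w] with [g : T B -> T A].

    For algebras [(A, a)] and [(B, b)], let [D] work for the carriers [A] and [B].
    The free algebra on [D] works for the algebras: a morphism [u : D -> A]
    extends to the algebra morphism [a ∘ T u] from [T D], so a coloring of algebra
    morphisms gives a coloring of [hom D A]; and composing with an algebra
    morphism [f] commutes with the extension, so the colors of the
    [f ∘ (b ∘ T w)] are among those of the [g ∘ w].

    The common pattern is [dual_ramsey_transfer], a weak form of adjunction
    known as a pre-adjunction. *)

Set Implicit Arguments.
Unset Strict Implicit.
Unset Printing Implicit Defensive.

Local Open Scope classical_set_scope.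
Local Open Scope card_scope.
Local Open Scope cat_scope.

(** Pulling a coloring back along [phi D] gives a coloring of [hom D (G A)];
    if [w] is good for it, then the hypothesis on [phi] places the colors of the
    [f ∘ phi D B w] inside the colors of the [g ∘ w], a set of at most one
    element. *)
Lemma dual_ramsey_transfer (C E : category) (F : C -> E) (G : E -> C)
    (phi : forall (D : C) (A : E), hom D (G A) -> hom (F D) A) :
  (forall (D : C) (A B : E) (w : hom D (G B)) (f : hom B A),
     exists g : hom (G B) (G A), f ∘ phi D B w = phi D A (g ∘ w)) ->
  dual_ramsey C -> dual_ramsey E.
Proof.
move=> phi_comp hC k k_ge2 A B.
have [D hD] := hC k k_ge2 (G A) (G B).
exists (F D) => chi.
have [w hw] := hD (fun u => chi (phi D A u)).
exists (phi D B w); apply: card_le_trans hw; apply: subset_card_le.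
move=> _ [_ [f _ <-] <-].
have [g ->] := phi_comp D A B w f.
by exists (g ∘ w) => //; exists g.
Qed.

Lemma kleisli_dual_ramsey (C : category) (T : monad C) :
  dual_ramsey C -> dual_ramsey (kleisli T).
Proof.
apply: (@dual_ramsey_transfer C (kleisli T) id T (fun _ _ u => u)).
by move=> D A B w f; exists (mu T A ∘ fmap T f).
Qed.

Definition free_algebra (C : category) (T : monad C) (D : C) : em_obj T :=
  EMObj (mu_assoc T D) (mu_etal T D).

(** Multiplicativity of the action and naturality of [mu] make the extension
    of [u] to the free algebra a morphism of algebras. *)
Lemma free_extensionP (C : category) (T : monad C) (D : C) (A : em_obj T)
    (u : hom D (carrier A)) :
  (action A ∘ fmap T u) ∘ action (free_algebra T D)
  = action A ∘ fmap T (action A ∘ fmap T u).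
Proof.
rewrite fmap_comp compose_assoc action_mu -!compose_assoc.
by rewrite -(naturality (mu T) u).
Qed.

Definition free_extension (C : category) (T : monad C) (D : C) (A : em_obj T)
    (u : hom D (carrier A)) : em_hom (free_algebra T D) A :=
  EMHom (free_extensionP u).

Lemma free_extension_comp (C : category) (T : monad C) (D : C) (A B : em_obj T)
    (f : em_hom B A) (w : hom D (carrier B)) :
  em_compose f (free_extension w) = free_extension (em_val f ∘ w).
Proof.
by apply: em_hom_eq; rewrite /= fmap_comp !compose_assoc em_valP.
Qed.

Lemma eilenberg_moore_dual_ramsey (C : category) (T : monad C) :
  dual_ramsey C -> dual_ramsey (eilenberg_moore T).
Proof.
apply: (@dual_ramsey_transfer C (eilenberg_moore T) (free_algebra T)
          (@carrier C T) (@free_extension C T)).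
by move=> D A B w f; exists (em_val f); exact: free_extension_comp.
Qed.

Theorem theorem3p12 (C : category) (T : monad C) (hC : dual_ramsey C) :
  dual_ramsey (kleisli T) /\ dual_ramsey (eilenberg_moore T).
Proof.
by split; [exact: kleisli_dual_ramsey | exact: eilenberg_moore_dual_ramsey].
Qed.
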